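(* Let $f:\mathbb{N}\to\{-1,1\}$ be a completely multiplicative function with the property that for some prime $p$, $f(p)=-1$. Then the power series $\sum_{n=1}^\infty f(n)z^{n}\in\mathbb{Z}[[z]]$ is transcendental over $\mathbb{Z}[z]$.
   Context: $\mathbb{N}=\{1,2,3,\dots\}$. A function $f:\mathbb{N}\to\{-1,1\}$ is completely multiplicative if $f(mn)=f(m)f(n)$ for all $m,n\in\mathbb{N}$. A power series $F(z)\in\mathbb{Z}[[z]]$ is transcendental over $\mathbb{Z}[z]$ if there is no nonzero polynomial $P(y)=a_d(z)y^d+\cdots+a_1(z)y+a_0(z)$ with coefficients $a_i(z)\in\mathbb{Z}[z]$ such that $P(F(z))=0$ in $\mathbb{Z}[[z]]$. *)

(* Defs.v *)
From HB Require Import structures.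
From mathcomp Require Import all_boot all_order all_algebra.
From mathcomp Require Import boolp.

Set Implicit Arguments.
Unset Strict Implicit.
Unset Printing Implicit Defensive.

Import GRing.Theory.
Local Open Scope ring_scope.

(* A wrapper around nat -> R, which carries the Cauchy product below, so that *)
(* the pointwise structure on functions cannot be inferred instead.           *)
Record fps (R : Type) := FPS { fps_coef : nat -> R }.

HB.instance Definition _ (R : Type) := gen_eqMixin (fps R).
HB.instance Definition _ (R : Type) := gen_choiceMixin (fps R).

Lemma fpsP (R : Type) (F G : fps R) :
  (forall n, fps_coef F n = fps_coef G n) -> F = G.
Proof. by case: F G => [a] [b] /= /funext ->. Qed.

Section FpsRing.
Variable R : comNzRingType.
Implicit Types F G H : fps R.

Definition fps_zero : fps R := FPS (fun=> 0).
Definition fps_opp F : fps R := FPS (fun n => - fps_coef F n).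
Definition fps_add F G : fps R := FPS (fun n => fps_coef F n + fps_coef G n).

Fact fps_addA : associative fps_add.
Proof. by move=> F G H; apply: fpsP => n /=; rewrite addrA. Qed.
Fact fps_addC : commutative fps_add.
Proof. by move=> F G; apply: fpsP => n /=; rewrite addrC. Qed.
Fact fps_add0 : left_id fps_zero fps_add.
Proof. by move=> F; apply: fpsP => n /=; rewrite add0r. Qed.
Fact fps_addN : left_inverse fps_zero fps_opp fps_add.
Proof. by move=> F; apply: fpsP => n /=; rewrite addNr. Qed.

HB.instance Definition _ := GRing.isZmodule.Build (fps R)
  fps_addA fps_addC fps_add0 fps_addN.

Definition fps_one : fps R := FPS (fun n => (n == 0%N)%:R).
Definition fps_mul F G : fps R :=
  FPS (fun n => \sum_(i < n.+1) fps_coef F i * fps_coef G (n - i)).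

Fact fps_mulC : commutative fps_mul.
Proof.
move=> F G; apply: fpsP => n /=; rewrite (reindex_inj rev_ord_inj) /=.
by apply: eq_bigr => j _; rewrite (sub_ordK j) mulrC.
Qed.

Fact fps_mulA : associative fps_mul.
Proof.
move=> F G H; apply: fpsP => n.
rewrite [fps_mul F (fps_mul G H)]/fps_mul /=.
pose coef3 j k := fps_coef F j * (fps_coef G (n - j - k) * fps_coef H k).
transitivity (\sum_(j < n.+1) \sum_(k < n.+1 | (k <= n - j)%N) coef3 j k).
  apply: eq_bigr => /= j _; rewrite (reindex_inj rev_ord_inj) big_distrr /=.
  rewrite (big_ord_narrow_leq (leq_subr _ _)); apply: eq_bigr => k _.
  by rewrite /coef3 (sub_ordK k).
rewrite (exchange_big_dep predT) //= [RHS](reindex_inj rev_ord_inj) /=.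
apply: eq_bigr => k _; rewrite (sub_ordK k).
transitivity (\sum_(j < n.+1 | (j <= n - k)%N) coef3 j k).
  apply: eq_bigl => j; rewrite -ltnS -(ltnS j) -!subSn ?leq_ord //.
  by rewrite -subn_gt0 -(subn_gt0 j) -!subnDA addnC.
rewrite (big_ord_narrow_leq (leq_subr _ _)) big_distrl /=.
by apply: eq_bigr => j _; rewrite /coef3 -!subnDA addnC mulrA.
Qed.

Fact fps_mul1 : left_id fps_one fps_mul.
Proof.
move=> F; apply: fpsP => n /=; rewrite big_ord_recl subn0 mul1r.
by rewrite big1 ?addr0 // => j _; rewrite mul0r.
Qed.

Fact fps_mulDl : left_distributive fps_mul fps_add.
Proof.
move=> F G H; apply: fpsP => n /=; rewrite -big_split.
by apply: eq_bigr => j _; rewrite mulrDl.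
Qed.

Fact fps_one_neq0 : fps_one != 0.
Proof.
apply/eqP => /(congr1 (fun F => fps_coef F 0)) /= /eqP.
by rewrite oner_eq0.
Qed.

HB.instance Definition _ := GRing.Zmodule_isComNzRing.Build (fps R)
  fps_mulA fps_mulC fps_mul1 fps_mulDl fps_one_neq0.

Definition fps_of_poly (p : {poly R}) : fps R := FPS (fun n => p`_n).

Fact fps_of_poly_is_zmod_morphism : zmod_morphism fps_of_poly.
Proof. by move=> p q; apply: fpsP => n /=; rewrite coefB. Qed.

HB.instance Definition _ := GRing.isZmodMorphism.Build {poly R} (fps R)
  fps_of_poly fps_of_poly_is_zmod_morphism.

Fact fps_of_poly_is_monoid_morphism : monoid_morphism fps_of_poly.
Proof.
by split=> [|p q]; apply: fpsP => n /=; rewrite ?coef1 // coefM.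
Qed.

HB.instance Definition _ := GRing.isMonoidMorphism.Build {poly R} (fps R)
  fps_of_poly fps_of_poly_is_monoid_morphism.

Definition transcendental_fps F : Prop :=
  ~ exists2 P : {poly {poly R}},
      P != 0 & (map_poly fps_of_poly P).[F] = 0.

End FpsRing.

(* f is a function on {1, 2, 3, ...}; the junk value f 0 is unconstrained.    *)
Definition completely_multiplicative (f : nat -> int) : Prop :=
  forall m n : nat, (0 < m)%N -> (0 < n)%N -> f (m * n)%N = f m * f n.

(* \sum_(n >= 1) f n z ^ n *)
Definition gen_series (f : nat -> int) : fps int :=
  FPS (fun n => if n is 0%N then 0 else f n).

(* Main.v *)
Require Import Defs.
From mathcomp Require Import all_boot all_order all_algebra.
From mathcomp Require Import boolp.
From mathcomp Require Import ring.

Set Implicit Arguments.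
Unset Strict Implicit.
Unset Printing Implicit Defensive.

Import Order.TTheory GRing.Theory Num.Theory.
Local Open Scope ring_scope.

(** An algebraic power series F over a domain R of characteristic 0 is
    holonomic: with theta = z d/dz, all the theta^k F lie in the finite
    dimensional R(z)-space generated by the powers of F, so finitely many of
    them are linearly dependent over R[z] ([euler_linear_relation]).  As theta^k
    multiplies the n-th coefficient by n^k, reading off coefficients gives a
    linear recurrence with polynomial coefficients for the coefficients a(n) of
    F ([algebraic_recurrence]):
      p_0(m) a(m) + ... + p_(r-1)(m) a(m+r-1) = 0.

    Suppose now that a takes finitely many values.  Only finitely many
    polynomials e_0 p_0 + ... + e_(r-1) p_(r-1) arise when the e_i range over
    those values, and each nonzero one is eventually nonvanishing on the
    integers.  Hence, for large m, the combination with e_i = a(m+i) is the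
    zero polynomial, and comparing the coefficients of a fixed monomial gives
    a recurrence with constant coefficients
    ([finite_range_constant_recurrence]).  Such a recurrence is a deterministic
    process on finitely many states, so a is eventually periodic
    ([constant_recurrence_eventually_periodic]).

    Finally, let f be completely multiplicative without zeros and eventually
    periodic of period T.  From f(Tn) = f(Tn + T) it follows that
    f(n) = f(n + 1) for large n, and then f(q) f(n) = f(qn) = f(n) forces
    f(q) = 1 for every q: no prime can be sent to -1. *)

(** * The domain of power series *)

(** The lowest terms of two nonzero series multiply to the lowest term of their
    product. *)
Lemma fps_mul_eq0 (R : idomainType) (F G : fps R) :
  F * G = 0 -> F = 0 \/ G = 0.
Proof.
have min_coef (H : fps R) : H <> 0 ->
    exists2 n, fps_coef H n != 0 & forall m, (m < n)%N -> fps_coef H m = 0.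
  move=> H_neq0; have exH : exists n, fps_coef H n != 0.
    apply: contrapT => /forallNP H0; apply: H_neq0; apply: fpsP => n.
    by apply/eqP/negPn/negP; exact: H0.
  case: (ex_minnP exH) => n Hn minn; exists n => // m m_lt_n.
  by apply/eqP/negPn/negP => /minn; rewrite leqNgt m_lt_n.
move=> FG0; have [|/min_coef[i Fi minF]] := EM (F = 0); first by left.
have [|/min_coef[j Gj minG]] := EM (G = 0); first by right.
have /eqP := congr1 (fun H => fps_coef H (i + j)%N) FG0 => /=.
have lt_i : (i < (i + j).+1)%N by rewrite ltnS leq_addr.
rewrite (bigD1 (Ordinal lt_i)) //= addKn big1 ?addr0; last first.
  move=> k; rewrite -val_eqE /= neq_ltn => /orP[/minF-> | lt_ik].
    by rewrite mul0r.
  rewrite minG ?mulr0 // ltn_subLR; first by rewrite ltn_add2r.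
  by rewrite -ltnS.
by rewrite mulf_eq0 (negPf Fi) (negPf Gj).
Qed.

Lemma fps_of_poly_inj (R : comNzRingType) : injective (@fps_of_poly R).
Proof.
move=> p q pq; apply/polyP => n.
by have := congr1 (fun F => fps_coef F n) pq.
Qed.

(** * The Euler derivation on algebraic series *)

Section Derivation.
Variable R : comNzRingType.
Implicit Types (F G : fps R) (P Q : {poly {poly R}}).

(** The operator z d/dz, preferred to d/dz because it does not shift indices. *)
Definition euler F : fps R := FPS (fun n => n%:R * fps_coef F n).

Lemma eulerD F G : euler (F + G) = euler F + euler G.
Proof. by apply: fpsP => n /=; rewrite mulrDr. Qed.

Lemma euler0 : euler 0 = 0.
Proof. by apply: fpsP => n /=; rewrite mulr0. Qed.

Lemma eulerM F G : euler (F * G) = euler F * G + F * euler G.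
Proof.
apply: fpsP => n /=; rewrite mulr_sumr -big_split; apply: eq_bigr => i _ /=.
by rewrite -{1}(subnKC (leq_ord i)) natrD; ring.
Qed.

Lemma euler1 : euler 1 = 0.
Proof. by apply: fpsP => -[|n] /=; rewrite (mul0r, mulr0). Qed.

(** The factor [G] keeps the exponent [n] on the right, where the power rule
    has n - 1. *)
Lemma eulerX G n : G * euler (G ^+ n) = n%:R * G ^+ n * euler G.
Proof.
elim: n => [|n IHn]; first by rewrite expr0 euler1 mulr0 !mul0r.
by rewrite exprS eulerM mulrDr mulrCA IHn -natr1; ring.
Qed.

Lemma euler_of_poly (p : {poly R}) :
  euler (fps_of_poly p) = fps_of_poly ('X * p^`()).
Proof.
apply: fpsP => -[|n] /=; first by rewrite mul0r coefXM.
by rewrite coefXM coef_deriv mulr_natl.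
Qed.

Lemma coef_iter_euler k F n :
  fps_coef (iter k euler F) n = n%:R ^+ k * fps_coef F n.
Proof. by elim: k => [|k IHk]; rewrite ?mul1r //= IHk exprS mulrA. Qed.

Definition series_eval F P : fps R := (map_poly (@fps_of_poly R) P).[F].

Lemma series_evalD F P Q :
  series_eval F (P + Q) = series_eval F P + series_eval F Q.
Proof. by rewrite /series_eval rmorphD hornerD. Qed.
Lemma series_evalM F P Q :
  series_eval F (P * Q) = series_eval F P * series_eval F Q.
Proof. by rewrite /series_eval rmorphM hornerM. Qed.
Lemma series_evalN F P : series_eval F (- P) = - series_eval F P.
Proof. by rewrite /series_eval rmorphN hornerN. Qed.
Lemma series_eval0 F : series_eval F 0 = 0.
Proof. by rewrite /series_eval rmorph0 horner0. Qed.
Lemma series_evalC F p : series_eval F p%:P = fps_of_poly p.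
Proof. by rewrite /series_eval map_polyC hornerC. Qed.
Lemma series_evalX F : series_eval F 'X = F.
Proof. by rewrite /series_eval map_polyX hornerX. Qed.
Lemma series_evalZ F p P :
  series_eval F (p *: P) = fps_of_poly p * series_eval F P.
Proof. by rewrite -mul_polyC series_evalM series_evalC. Qed.
Lemma series_evalXn F P n : series_eval F (P ^+ n) = series_eval F P ^+ n.
Proof. by rewrite /series_eval rmorphXn horner_exp. Qed.
Lemma series_eval_nat F n : series_eval F n%:R = n%:R.
Proof. by rewrite /series_eval rmorph_nat -polyC_natr hornerC. Qed.
Lemma series_eval_sum F n (P : 'I_n -> {poly {poly R}}) :
  series_eval F (\sum_i P i) = \sum_i series_eval F (P i).
Proof. by rewrite /series_eval rmorph_sum horner_sum. Qed.

(** Chain rule: [S] is obtained from [Q] by applying the derivation to its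
    coefficients. *)
Lemma euler_series_eval F Q : exists S,
  euler (series_eval F Q) = series_eval F S + series_eval F Q^`() * euler F.
Proof.
elim/poly_ind: Q => [|Q c [S IHQ]].
  by exists 0; rewrite deriv0 !series_eval0 euler0 mul0r addr0.
exists (S * 'X + ('X * c^`())%:P).
rewrite derivD derivM derivX derivC mulr1 addr0.
rewrite !series_evalD !series_evalM !series_evalC series_evalX.
by rewrite eulerD eulerM IHQ euler_of_poly; ring.
Qed.

(** Differentiating P(F) = 0 gives P'(F) theta F = - S(F) for a polynomial S, so
    theta maps R[z][F] into itself up to the denominator D = P'(F).  By the
    quotient rule each further application of theta costs at most D^2; the
    statement is free of fractions, so that it makes sense even when D is not
    invertible. *)
Lemma iter_euler_denominator F P k : series_eval F P = 0 ->
  exists Q, series_eval F P^`() ^+ (2 * k) * iter k euler F = series_eval F Q.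
Proof.
move=> PF0; set D := series_eval F P^`().
have [S0 DS0] : exists S, D * euler F = series_eval F S.
  have [S] := euler_series_eval F P; rewrite PF0 => S0; exists (- S).
  by rewrite series_evalN; apply/eqP; rewrite -addr_eq0 addrC -S0 euler0.
have Deuler Q : exists S, D * euler (series_eval F Q) = series_eval F S.
  have [S ->] := euler_series_eval F Q; exists (P^`() * S + Q^`() * S0).
  by rewrite series_evalD !series_evalM -DS0 -/D; ring.
elim: k => [|k [Q IHk]]; first by exists 'X; rewrite mul1r series_evalX.
have [S1 DS1] := Deuler Q; have [S2 DS2] := Deuler P^`().
(* [D ^+ 2] times the Leibniz rule for [D ^+ (2 * k) * iter k euler F], where
   [D ^+ 2 * euler (D ^+ (2 * k))] is [D ^+ (2 * k)] times an element of
   R[z][F]. *)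
exists (P^`() * S1 - (2 * k)%:R * S2 * Q).
have := eulerM (D ^+ (2 * k)) (iter k euler F); rewrite IHk => eQ.
rewrite series_evalD series_evalN !series_evalM series_eval_nat -DS1 -DS2 eQ.
rewrite -IHk -/D /= mulnS exprD.
have -> : D * (D * (euler (D ^+ (2 * k)) * iter k euler F +
    D ^+ (2 * k) * euler (iter k euler F))) =
  D * (D * euler (D ^+ (2 * k))) * iter k euler F +
    D * D * D ^+ (2 * k) * euler (iter k euler F) by ring.
rewrite eulerX; ring.
Qed.

End Derivation.

(** * Holonomicity of algebraic series *)

(** [d.+1] vectors in the rank [d] module of polynomials of degree less than [d]
    are dependent; over a domain the vanishing of a determinant provides the
    relation directly. *)
Lemma poly_linear_relation (A : idomainType) d (Q : 'I_d.+1 -> {poly A}) :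
  (forall i, (size (Q i) <= d)%N) ->
  exists2 v : 'I_d.+1 -> A, (exists i, v i != 0) & \sum_i v i *: Q i = 0.
Proof.
move=> sQ; pose M := \matrix_(i < d.+1, j < d.+1) (Q i)`_j.
(* The last column, made of the coefficients of degree [d], is zero. *)
have /det0P[v v_neq0 vM0] : \det M == 0.
  rewrite (expand_det_col _ ord_max) big1 // => i _.
  by rewrite mxE nth_default ?mul0r.
exists (v 0); first by apply/rV0Pn.
apply/polyP => j; rewrite coef_sum coef0.
under eq_bigr do rewrite coefZ.
have [lt_jd | le_dj] := ltnP j d.+1; last first.
  rewrite big1 // => i _; rewrite nth_default ?mulr0 //.
  by rewrite (leq_trans (sQ i)) // ltnW.
have := congr1 (fun w : 'rV_d.+1 => w 0 (Ordinal lt_jd)) vM0.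
rewrite !mxE => rel_j; rewrite -[RHS]rel_j.
by apply: eq_bigr => i _; rewrite mxE.
Qed.

Section Holonomic.
Variable R : numDomainType.
Implicit Types (F : fps R) (P : {poly {poly R}}).

(** An annihilating polynomial of least degree is separable at [F], because its
    derivative is a nonzero polynomial of smaller degree: characteristic 0 is
    used here. *)
Lemma minimal_annihilator F : ~ transcendental_fps F ->
  exists P, [/\ P != 0, series_eval F P = 0 & series_eval F P^`() <> 0].
Proof.
move=> /contrapT[P0 P0_neq0 P0F].
pose ann n := `[< exists P, [/\ P != 0, series_eval F P = 0 & size P = n] >].
have ex_ann : exists n, ann n by exists (size P0); apply/asboolP; exists P0.
case: (ex_minnP ex_ann) => n /asboolP[P [P_neq0 PF0 sP]] min_n.
exists P; split=> // P'F0.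
have sP1 : (1 < size P)%N.
  rewrite ltnNge; apply/negP => /size1_polyC Pc; move: PF0 P_neq0.
  rewrite Pc series_evalC -(rmorph0 (@fps_of_poly R)) => /fps_of_poly_inj ->.
  by rewrite polyC0 eqxx.
have P'_neq0 : P^`() != 0.
  apply/eqP => /polyP/(_ (size P).-2) /eqP.
  rewrite coef_deriv coef0 prednK; last by rewrite -ltnS prednK // ltnW.
  rewrite -mulr_natr mulf_eq0 -/(lead_coef P) lead_coef_eq0 (negPf P_neq0) /=.
  by rewrite -polyC_natr polyC_eq0 pnatr_eq0 -leqn0 leqNgt ltn_predRL sP1.
have /min_n : ann (size P^`()) by apply/asboolP; exists P^`().
by rewrite leqNgt -sP lt_size_deriv.
Qed.

(** Up to the common denominator [D ^+ (2 * d)], each theta^k F with k <= d is a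
    polynomial in F, and pseudo-division by P brings its degree below
    d = deg P at the cost of a power of the leading coefficient of P.  These
    [d.+1] remainders are dependent, and the denominators can be cancelled in
    the domain of power series. *)
Lemma euler_linear_relation F : ~ transcendental_fps F ->
  exists d (w : 'I_d -> {poly R}),
    (exists i, w i != 0) /\ \sum_i fps_of_poly (w i) * iter i (@euler R) F = 0.
Proof.
move=> /minimal_annihilator[P [P_neq0 PF0 D_neq0]].
set D := series_eval F _ in D_neq0; pose d := (size P).-1; exists d.+1.
have reduce (i : 'I_d.+1) : exists cQ : {poly R} * {poly {poly R}},
    [/\ cQ.1 != 0, (size cQ.2 <= d)%N &
        fps_of_poly cQ.1 * (D ^+ (2 * d) * iter i (@euler R) F)
          = series_eval F cQ.2].
  have [Q0 Q0P] := iter_euler_denominator i PF0.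
  pose Q := P^`() ^+ (2 * (d - i)) * Q0.
  exists (lead_coef P ^+ scalp Q P, Q %% P) => /=.
  split; first by rewrite expf_neq0 // lead_coef_eq0.
    by rewrite -ltnS prednK ?size_poly_gt0 // ltn_modp.
  have := congr1 (series_eval F) (Pdiv.Idomain.divp_eq Q P).
  rewrite series_evalZ series_evalD (series_evalM F (Q %/ P)) PF0 mulr0 add0r.
  move=> <-; congr (_ * _); rewrite series_evalM series_evalXn -Q0P mulrA.
  by rewrite -exprD -mulnDr subnK // -ltnS.
have [cQ cQP] := choice reduce.
have [v [i vi] relv] := @poly_linear_relation _ d (fun i => (cQ i).2)
  (fun i => let: And3 _ s _ := cQP i in s).
exists (fun i => v i * (cQ i).1); split.
  by exists i; rewrite mulf_neq0 //; case: (cQP i).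
have: D ^+ (2 * d) *
    (\sum_i fps_of_poly (v i * (cQ i).1) * iter i (@euler R) F) = 0.
  have := congr1 (series_eval F) relv.
  rewrite series_eval_sum series_eval0 => rel0.
  rewrite -[RHS]rel0 mulr_sumr; apply: eq_bigr => j _; case: (cQP j) => _ _ jP.
  by rewrite series_evalZ -jP rmorphM /=; ring.
move=> /fps_mul_eq0[|//] DX0; exfalso; move: DX0.
elim: (2 * d)%N => [/eqP|m IHm]; first by rewrite expr0 oner_eq0.
by rewrite exprS => /fps_mul_eq0[].
Qed.

(** The n-th coefficient of z^j theta^k F is (n - j)^k a(n - j).  Collecting the
    terms of the linear relation by j, the coefficient of a(n - j) is q_j(n - j)
    where q_j has the coefficients of z^j in the w_k, so that some q_j is
    nonzero. *)
Lemma algebraic_recurrence F : ~ transcendental_fps F ->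
  exists r (p : 'I_r -> {poly R}),
    (exists i, p i != 0) /\
    forall m, \sum_i (p i).[m%:R] * fps_coef F (m + i) = 0.
Proof.
move=> /euler_linear_relation[d [w [[k0 wk0] rel]]].
pose r := \max_i size (w i); exists r.+1.
have le_size k : (size (w k) <= r)%N.
  exact: (leq_bigmax (F := fun i => size (w i)) k).
pose q i := \poly_(k < d) (if insub k is Some k' then (w k')`_i else 0).
have qE i x : (q i).[x] = \sum_(k < d) (w k)`_i * x ^+ k.
  rewrite horner_poly; apply: eq_bigr => k _.
  by rewrite valK.
(* With n = m + r, the index i counts upwards from m, i.e. i = r - j. *)
exists (fun i : 'I_r.+1 => q (r - i)%N \Po ('X + (i : nat)%:R%:P)); split.
  have lek0 : ((size (w k0)).-1 <= r)%N by rewrite (leq_trans (leq_pred _)).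
  have le1 : (r - (size (w k0)).-1 < r.+1)%N by rewrite ltnS leq_subr.
  exists (Ordinal le1); rewrite comp_poly2_eq0 ?size_XaddC //= subKn //.
  apply/eqP => /polyP/(_ k0); rewrite coef0 coef_poly ltn_ord valK => /eqP.
  by rewrite -/(lead_coef _) lead_coef_eq0 (negPf wk0).
move=> m; have := congr1 (fun G => fps_coef G (m + r)%N) rel.
have -> : fps_coef (\sum_i fps_of_poly (w i) * iter i (@euler R) F) (m + r)%N
    = \sum_i fps_coef (fps_of_poly (w i) * iter i (@euler R) F) (m + r)%N.
  by apply: (big_morph (fun G => fps_coef G (m + r)%N)).
move=> rel_n; rewrite -[RHS]rel_n.
transitivity (\sum_(i < r.+1) \sum_(k < d) (w k)`_i *
    ((m + r - i)%:R ^+ k * fps_coef F (m + r - i))).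
  rewrite (reindex_inj rev_ord_inj) /=; apply: eq_bigr => i _.
  have ler := leq_ord i.
  rewrite horner_comp !hornerE subSS subKn // qE mulr_suml.
  by apply: eq_bigr => k _; rewrite -natrD -addnBA // mulrA.
rewrite exchange_big /=; apply: eq_bigr => k _.
pose g j := (w k)`_j * ((m + r - j)%:R ^+ k * fps_coef F (m + r - j)).
transitivity (\sum_(j < (m + r).+1) g j); last first.
  by apply: eq_bigr => j _; rewrite coef_iter_euler.
rewrite -!(big_mkord xpredT g).
rewrite [RHS](big_cat_nat (n := r.+1)) ?ltnS ?leq_addl //=.
(* No [w k] has terms of degree above [r]. *)
rewrite [X in _ = _ + X]big_nat_cond [X in _ = _ + X]big1 ?addr0 // => j.
case/andP=> /andP[ltrj _] _.
by rewrite /g nth_default ?mul0r // (leq_trans (le_size k)) // ltnW.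
Qed.

(** * Recurrences for sequences with finitely many values *)

Lemma poly_eventually_neq0 (p : {poly R}) : p != 0 ->
  exists M, forall m, (M <= m)%N -> p.[m%:R] != 0.
Proof.
have [n] := ubnP (size p); elim: n p => // n IHn p sp p_neq0.
have [[m0 root_m0] | noroot] := EM (exists m : nat, root p m%:R); last first.
  by exists 0%N => m _; apply/negP => pm0; apply: noroot; exists m.
have [q pE] := factor_theorem p m0%:R root_m0.
have q_neq0 : q != 0 by apply: contra_neq p_neq0 => q0; rewrite pE q0 mul0r.
have [|M qM] := IHn q _ q_neq0.
  by move: sp; rewrite pE size_Mmonic ?monicXsubC // size_XsubC addn2.
exists (maxn M m0.+1) => m; rewrite geq_max => /andP[leM ltm0].
rewrite pE hornerM mulf_neq0 ?qM // hornerXsubC subr_eq0 eqr_nat.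
by rewrite gtn_eqF.
Qed.

(** The finitely many possible value patterns (e_0, ..., e_(r-1)) let one choose
    a uniform bound beyond which every nonzero combination of the [p i] is
    nonvanishing. *)
Lemma finite_range_constant_recurrence (a : nat -> R) (s : seq R) r
    (p : 'I_r -> {poly R}) :
  (forall n, a n \in s) -> (exists i, p i != 0) ->
  (forall m, \sum_i (p i).[m%:R] * a (m + i)%N = 0) ->
  exists M (c : 'I_r -> R), (exists i, c i != 0) /\
    forall m, (M <= m)%N -> \sum_i c i * a (m + i)%N = 0.
Proof.
move=> a_s [i0 pi0] rec.
pose W := {ffun 'I_r -> seq_sub s}.
pose pW (e : W) := \sum_i ssval (e i) *: p i.
have exM (e : W) : exists M,
    pW e != 0 -> forall m, (M <= m)%N -> (pW e).[m%:R] != 0.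
  have [->|/poly_eventually_neq0[M MP]] := eqVneq (pW e) 0; last by exists M.
  by exists 0%N.
have [M MP] := choice exM.
(* Any monomial occurring in some [p i] would do; this one occurs in [p i0]. *)
exists (\max_e M e), (fun i => (p i)`_(size (p i0)).-1); split.
  by exists i0; rewrite -/(lead_coef _) lead_coef_eq0.
move=> m leMm; pose e : W := [ffun i : 'I_r => SeqSub (a_s (m + i)%N)].
have e0 : pW e = 0.
  have leMe : (M e <= m)%N := leq_trans (leq_bigmax (F := M) e) leMm.
  apply/eqP/negPn/negP => /MP/(_ m leMe)/eqP; apply.
  rewrite horner_sum -[RHS](rec m); apply: eq_bigr => i _.
  by rewrite hornerZ ffunE mulrC.
have := congr1 (fun g : {poly R} => g`_(size (p i0)).-1) e0.
rewrite coef0 coef_sum => e0k; rewrite -[RHS]e0k; apply: eq_bigr => i _.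
by rewrite coefZ ffunE mulrC.
Qed.

End Holonomic.

(** Let [c l] be the last nonzero coefficient.  The recurrence determines
    a(m + l) from the state (a(m), ..., a(m + l - 1)).  There are finitely many
    states, so one of them recurs, and from then on the sequence repeats. *)
Lemma constant_recurrence_eventually_periodic (R : idomainType) (a : nat -> R)
    (s : seq R) r (c : 'I_r -> R) M :
  (forall n, a n \in s) -> (exists i, c i != 0) ->
  (forall m, (M <= m)%N -> \sum_i c i * a (m + i)%N = 0) ->
  exists T N, (0 < T)%N /\ forall n, (N <= n)%N -> a (n + T)%N = a n.
Proof.
move=> a_s [i0 ci0] rec.
have [l cl maxl] := @arg_maxnP _ i0 (fun i => c i != 0) (@nat_of_ord r) ci0.
pose W := {ffun 'I_l -> seq_sub s}.
pose state m : W := [ffun i : 'I_l => SeqSub (a_s (m + i)%N)].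
have agree m n : state m = state n ->
    forall i, (i < l)%N -> a (m + i)%N = a (n + i)%N.
  move=> /ffunP st i lti; have := st (Ordinal lti).
  by rewrite !ffunE => /(congr1 val).
have next m n : (M <= m)%N -> (M <= n)%N -> state m = state n ->
    a (m + l)%N = a (n + l)%N /\ state m.+1 = state n.+1.
  move=> leMm leMn st; have al : a (m + l)%N = a (n + l)%N.
    have : c l * a (m + l)%N = c l * a (n + l)%N.
      have := etrans (rec m leMm) (esym (rec n leMn)).
      rewrite (bigD1 l) //= [in RHS](bigD1 l) //=.
      rewrite [X in _ = _ + X](eq_bigr (fun i : 'I_r => c i * a (m + i)%N)).
        exact: addIr.
      move=> i neq_il; have [-> | ci] := eqVneq (c i) 0.
        by rewrite !mul0r.
      rewrite (agree _ _ st) // ltn_neqAle; apply/andP; split=> //.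
      exact: maxl.
    exact: mulfI.
  split=> //; apply/ffunP => i; rewrite !ffunE; apply: val_inj => /=.
  rewrite !addSnnS; have := ltn_ord i; rewrite leq_eqVlt => /predU1P[->//|].
  exact: agree.
have [i [j neq_ij st_ij]] : exists i, exists2 j : 'I_#|{: W}|.+1,
    i != j & state (M + i)%N = state (M + j)%N.
  apply/injectivePn/injectiveP => /leq_card.
  by rewrite card_ord ltnn.
wlog lt_ij : i j neq_ij st_ij / (i < j)%N.
  move=> wl; case: (ltngtP i j) => [| |eqij]; first exact: wl.
    by apply: wl; rewrite // eq_sym.
  by case/eqP: neq_ij; apply: val_inj.
exists (j - i)%N, (M + i + l)%N; split; first by rewrite subn_gt0.
have st k : state (M + i + k)%N = state (M + j + k)%N.
  elim: k => [|k IHk]; first by rewrite !addn0.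
  by rewrite !addnS; apply: (next _ _ _ _ IHk).2; rewrite -addnA leq_addr.
move=> n len; set k := (n - (M + i + l))%N.
have nE : n = (M + i + k + l)%N by rewrite addnAC subnKC.
have -> : (n + (j - i))%N = (M + j + k + l)%N.
  by rewrite nE -(subnKC (ltnW lt_ij)) addKn !addnA; ring.
rewrite nE; apply/esym; apply: (next _ _ _ _ (st k)).1;
  by rewrite -addnA leq_addr.
Qed.

Lemma algebraic_finite_range_eventually_periodic (R : numDomainType)
    (F : fps R) (s : seq R) :
  ~ transcendental_fps F -> (forall n, fps_coef F n \in s) ->
  exists T N, (0 < T)%N /\
    forall n, (N <= n)%N -> fps_coef F (n + T) = fps_coef F n.
Proof.
move=> /algebraic_recurrence[r [p [p_neq0 rec]]] F_s.
have [M [c [c_neq0 crec]]] := finite_range_constant_recurrence F_s p_neq0 rec.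
exact: constant_recurrence_eventually_periodic F_s c_neq0 crec.
Qed.

(** * Eventually periodic completely multiplicative functions *)

(** On the multiples of [T], complete multiplicativity turns invariance under the
    shift by [T] into invariance under the shift by 1, so [f] is eventually
    constant. *)
Lemma periodic_completely_multiplicative (f : nat -> int) T N :
    completely_multiplicative f -> (forall n, (0 < n)%N -> f n != 0) ->
    (0 < T)%N -> (forall n, (N < n)%N -> f (n + T)%N = f n) ->
  forall q, (0 < q)%N -> f q = 1.
Proof.
move=> f_mul f_neq0 T_gt0 perf q q_gt0.
have f_succ n : (N < n)%N -> f n.+1 = f n.
  move=> ltNn; have n_gt0 : (0 < n)%N by apply: leq_trans ltNn.
  apply: (mulfI (f_neq0 T T_gt0)); rewrite -!f_mul // mulnSr perf //.
  by rewrite (leq_trans ltNn) // leq_pmull.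
have f_const k : f (N.+1 + k)%N = f N.+1.
  by elim: k => [|k IHk]; rewrite ?addn0 // addnS f_succ // leq_addr.
apply: (mulIf (f_neq0 N.+1 isT)); rewrite mul1r -f_mul //.
by rewrite -(subnKC (leq_pmull N.+1 q_gt0)) f_const.
Qed.

Theorem theorem2 (f : nat -> int)
  (f_pm1 : forall n : nat, (0 < n)%N -> f n = -1 \/ f n = 1)
  (f_mul : completely_multiplicative f)
  (f_prime : exists p : nat, prime p /\ f p = -1) :
  transcendental_fps (gen_series f).
Proof.
apply: contrapT => algF.
have F_vals n : fps_coef (gen_series f) n \in [:: 0; -1; 1].
  by case: n => [|n] //=; case: (f_pm1 n.+1 isT) => ->.
have [T [N [T_gt0 perF]]] :=
  algebraic_finite_range_eventually_periodic algF F_vals.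
have f_neq0 n : (0 < n)%N -> f n != 0 by move=> /f_pm1[] ->.
(* The coefficient of index 0 need not be [f 0], hence the strict inequality. *)
have perf n : (N < n)%N -> f (n + T)%N = f n.
  by case: n => // n /ltnW/perF.
case: f_prime => p [/prime_gt0 p_gt0].
by rewrite (periodic_completely_multiplicative f_mul f_neq0 T_gt0 perf p_gt0).
Qed.
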